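(* Let $\mathbf{M}=(M_0,M_1,\ldots,M_k)$, $M_i\in\mathbb{R}^{n\times n}$, have the row $\mathcal{W}$-property. Then for any block vectors $\mathbf{q}=(q_0,q_1,\ldots,q_k)$ and $\tilde{\mathbf{q}}=(\tilde q_0,\tilde q_1,\ldots,\tilde q_k)$ with $q_i,\tilde q_i\in\mathbb{R}^n$, EVLCP $(\mathbf{M},\mathbf{q})$ and EVLCP $(\mathbf{M},\tilde{\mathbf{q}})$ have unique solutions $x^*$ and $y^*$, respectively. Furthermore, $$\|x^*-y^*\|\le \sum_{i=0}^{k}\alpha_i(\mathbf{M})\,\|\tilde q_i-q_i\|.$$
   Context: EVLCP $(\mathbf{M},\mathbf{q})$, for $\mathbf{M}=(M_0,\ldots,M_k)$ with $M_i\in\mathbb{R}^{n\times n}$ and $\mathbf{q}=(q_0,\ldots,q_k)$ with $q_i\in\mathbb{R}^n$, is the problem of finding $x\in\mathbb{R}^n$ with $\min\{M_0x+q_0,M_1x+q_1,\ldots,M_kx+q_k\}=0$, where $\min$ is the componentwise minimum. $\mathbf{M}$ has the row $\mathcal{W}$-property if $\min(M_0x,\ldots,M_kx)\le 0\le \max(M_0x,\ldots,M_kx)$ (componentwise min, max and inequalities) implies $x=0$. $\mathcal{D}$ is the set of all tuples $(D_0,\ldots,D_k)$ of $n\times n$ diagonal matrices with diagonal entries in $[0,1]$ and $\sum_{i=0}^kD_i=I$. For $(D_0,\ldots,D_k)\in\mathcal{D}$ put $S_{\mathbf{M}}=\sum_{i=0}^kD_iM_i$ (nonsingular for every such tuple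 when $\mathbf{M}$ has the row $\mathcal{W}$-property), and $\alpha_i(\mathbf{M})=\max_{(D_0,\ldots,D_k)\in\mathcal{D}}\|S_{\mathbf{M}}^{-1}D_i\|$ for $i=0,\ldots,k$. $\|\cdot\|$ denotes a fixed vector $p$-norm with $p\ge 1$ ($p=\infty$ allowed) and, for matrices, its induced operator norm. *)

(* Defs.v *)
From HB Require Import structures.
From mathcomp Require Import all_boot all_order all_algebra.
From mathcomp Require Import all_classical all_reals all_analysis.

Set Implicit Arguments.
Unset Strict Implicit.
Unset Printing Implicit Defensive.

Import Order.TTheory GRing.Theory Num.Theory.

Local Open Scope classical_set_scope.
Local Open Scope ring_scope.

Section Defs.
Context {R : realType}.

(* The default element of the iterated min (max) is the 0th vector itself, so
   these are the genuine minimum and maximum of the k + 1 vectors. *)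
Definition cmin n k (v : 'I_k.+1 -> 'cV[R]_n) : 'cV[R]_n :=
  \col_j \big[Num.min/v ord0 j 0]_(i < k.+1) v i j 0.

Definition cmax n k (v : 'I_k.+1 -> 'cV[R]_n) : 'cV[R]_n :=
  \col_j \big[Num.max/v ord0 j 0]_(i < k.+1) v i j 0.

Definition EVLCP_sol n k (M : 'I_k.+1 -> 'M[R]_n) (q : 'I_k.+1 -> 'cV[R]_n)
    (x : 'cV[R]_n) : Prop :=
  cmin (fun i => M i *m x + q i) = 0.

Definition row_W_property n k (M : 'I_k.+1 -> 'M[R]_n) : Prop :=
  forall x : 'cV[R]_n,
    (forall j, cmin (fun i => M i *m x) j 0 <= 0) ->
    (forall j, 0 <= cmax (fun i => M i *m x) j 0) ->
    x = 0.

Definition diag_tuples n k : set ('I_k.+1 -> 'M[R]_n) :=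
  [set D | [/\ forall i, is_diag_mx (D i),
               forall i j, 0 <= D i j j <= 1 &
               \sum_(i < k.+1) D i = 1%:M]].

Definition S_mx n k (M D : 'I_k.+1 -> 'M[R]_n) : 'M[R]_n :=
  \sum_(i < k.+1) D i *m M i.

(* Only meaningful for 1 <= p; the value at -oo is a placeholder. *)
Definition pnorm (p : \bar R) n (x : 'cV[R]_n) : R :=
  match p with
  | r%:E => (\sum_(j < n) `|x j 0| `^ r) `^ r^-1
  | +oo%E => \big[Num.max/0]_(j < n) `|x j 0|
  | -oo%E => 0
  end.

(* The unit ball rather than the unit sphere, which is empty when n = 0. *)
Definition opnorm (p : \bar R) n (A : 'M[R]_n) : R :=
  sup [set pnorm p (A *m x) | x in [set x : 'cV[R]_n | pnorm p x <= 1]].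

(* The greatest element of A, and 0 if A has none. *)
Definition set_max (A : set R) : R := xget 0 (A `&` ubound A).

Definition alpha (p : \bar R) n k (M : 'I_k.+1 -> 'M[R]_n) (i : 'I_k.+1) : R :=
  set_max [set opnorm p (invmx (S_mx M D) *m D i) | D in @diag_tuples n k].

End Defs.

(* Main.v *)
Require Import Defs.
From HB Require Import structures.
From mathcomp Require Import all_boot all_order all_algebra.
From mathcomp Require Import all_classical all_reals all_analysis.
From mathcomp Require Import ring lra.

Set Implicit Arguments.
Unset Strict Implicit.
Unset Printing Implicit Defensive.

Import Order.TTheory GRing.Theory Num.Theory.
Import numFieldNormedType.Exports.
Local Open Scope ring_scope.

(** The row W-property acts through its sign form [row_W_eq0]: a vector [x]
    vanishes as soon as, in every row, some [M i *m x] has an entry [<= 0] and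
    some [M i *m x] has an entry [>= 0].

    Existence needs no topology. Allow each row [j] to use only a nonempty set
    [J j] of the indices ([selective_sol]). If all these sets are singletons
    the problem is a linear system, whose matrix is invertible by the
    W-property. If [J j] has at least two elements, one of which is [b], let
    [x] solve the problem with [J j :\ b] in row [j], and [y] the problem with
    [b] alone. Either [x] satisfies the missing inequality for [b], or [y]
    satisfies those for [J j :\ b]: otherwise, in row [j], the residuals of [x]
    and [y] compare in one direction at [b] and in the other at the index that
    fails for [y]; in the other rows they compare in both directions because
    both solve the same problem there. So [row_W_eq0] gives [x = y], which is absurd. Induction on
    the total number of allowed indices concludes ([selective_sol_exists]).
    Uniqueness is the same comparison of residuals ([selective_sol_inj]).

    For the bound, in each row the residuals of the two solutions [x] and [y]
    are nonnegative and vanish at some index. Their difference is therefore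
    [<= 0] at one index and [>= 0] at another, so that some convex combination of it over the indices is zero.
    Collecting these weights in diagonal matrices gives
    [S *m (x - y) = \sum_i D i *m (qt i - q i)] with [S = S_mx M D]
    ([difference_weights]). The matrix [S] is invertible by the W-property
    again, and the triangle inequality yields the estimate with the operator
    norms of [invmx S *m D i] in place of the [alpha p M i].

    What remains is that [alpha] does bound these norms, that is, that the
    maximum in its definition exists ([opnorm_attains_max]). The tuples of
    diagonal matrices form a compact set of weights, and the operator norm
    depends continuously on the entries because it is 1-Lipschitz for the sum
    of their absolute values ([opnorm_le_add]). This estimate holds for every
    vector norm lying between the largest absolute value of the coordinates
    and the sum of these absolute values; for the p-norm, being a norm rests
    on Minkowski's inequality [pnormD]. *)

(** * The vector p-norm *)

Section PNorm.
Context {R : realType}.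

Lemma pnormE (r : R) n (x : 'cV[R]_n) : 1 <= r ->
  pnorm r%:E x `^ r = \sum_(j < n) `|x j 0| `^ r.
Proof.
move=> r1; have r0 : r != 0 by rewrite gt_eqF// (lt_le_trans _ r1).
by rewrite -powRrM mulVf// powRr1// sumr_ge0// => j _; exact: powR_ge0.
Qed.

Lemma pnorm_ge0 p n (x : 'cV[R]_n) : 0 <= pnorm p x.
Proof. by case: p => [r||] //=; rewrite ?powR_ge0// bigmax_ge_id. Qed.

Lemma pnormZ p n (a : R) (x : 'cV[R]_n) : (1 <= p)%E ->
  pnorm p (a *: x) = `|a| * pnorm p x.
Proof.
case: p => [r| |//].
  rewrite lee_fin => r1 /=.
  have r0 : r != 0 by rewrite gt_eqF// (lt_le_trans _ r1).
  under eq_bigr do rewrite mxE normrM powRM//.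
  rewrite -mulr_sumr powRM ?powR_ge0//; last first.
    by apply: sumr_ge0 => j _; exact: powR_ge0.
  by rewrite -powRrM mulfV// powRr1.
move=> _ /=; under eq_bigr do rewrite mxE normrM.
elim/big_rec2: _ => [|j u v _ ->]; first by rewrite mulr0.
by rewrite maxr_pMr.
Qed.

Lemma coord_le_pnorm p n (x : 'cV[R]_n) j : (1 <= p)%E -> `|x j 0| <= pnorm p x.
Proof.
case: p => [r| |//]; last first.
  by move=> _; exact: (le_bigmax 0 (fun j => `|x j 0|)).
rewrite lee_fin => r1; have r0 : r != 0 by rewrite gt_eqF// (lt_le_trans _ r1).
rewrite /= -[leLHS]powRr1// -(mulfV r0) powRrM ge0_ler_powR//.
- by rewrite invr_ge0 (le_trans _ r1).
- by rewrite nnegrE powR_ge0.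
- by rewrite nnegrE sumr_ge0// => i _; exact: powR_ge0.
- by rewrite (bigD1 j)//= lerDl sumr_ge0// => i _; exact: powR_ge0.
Qed.

Lemma pnorm_eq0 p n (x : 'cV[R]_n) : (1 <= p)%E -> pnorm p x = 0 -> x = 0.
Proof.
move=> p1 x0; apply/colP => j; rewrite mxE; apply/eqP.
by rewrite -normr_le0 -x0 coord_le_pnorm.
Qed.

Lemma pnorm0 p n : (1 <= p)%E -> pnorm p (0 : 'cV[R]_n) = 0.
Proof. by move=> p1; rewrite -(scale0r 0) pnormZ// normr0 mul0r. Qed.

Lemma powR_weighted_le (r s t a b : R) : 1 <= r -> 0 <= s -> 0 <= t ->
  s + t = 1 -> 0 <= a -> 0 <= b ->
  (s * a + t * b) `^ r <= s * a `^ r + t * b `^ r.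
Proof.
move=> r1 s0 t0 st a0 b0.
have s1 : s <= 1 by rewrite -st lerDl.
have := @convex_powR R r r1 (Itv01 s0 s1) a b; rewrite !inE/= !in_itv/= !andbT.
move=> /(_ a0 b0); have -> : t = unstable.onem s by rewrite /unstable.onem -st addrC addKr.
exact.
Qed.

(** Minkowski's inequality. With [a], [b] the norms of [x], [y], convexity of the
    power bounds [(|x j| + |y j|) / (a + b)] raised to [r] by the average, with
    weights [a / (a + b)] and [b / (a + b)], of the same powers of [|x j| / a]
    and [|y j| / b], and these sum to 1 over [j]. *)
Lemma pnormD p n (x y : 'cV[R]_n) : (1 <= p)%E ->
  pnorm p (x + y) <= pnorm p x + pnorm p y.
Proof.
case: p => [r| |//]; last first.
  move=> p1 /=; apply/bigmax_leP; split; first by rewrite addr_ge0 ?bigmax_ge_id.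
  move=> j _; rewrite mxE (le_trans (ler_normD _ _))// lerD//.
    exact: (le_bigmax 0 (fun j => `|x j 0|)).
  exact: (le_bigmax 0 (fun j => `|y j 0|)).
move=> p1; have := p1; rewrite lee_fin => r1.
have r0 : 0 < r by rewrite (lt_le_trans _ r1).
have normalized (z : 'cV[R]_n) : 0 < pnorm r%:E z ->
    \sum_j (`|z j 0| / pnorm r%:E z) `^ r = 1.
  move=> z0; have zr0 : pnorm r%:E z `^ r != 0 by rewrite gt_eqF// powR_gt0.
  apply: (mulIf zr0); rewrite mul1r mulr_suml [RHS]pnormE//; apply: eq_bigr => j _.
  by rewrite -powRM ?divr_ge0 ?pnorm_ge0// divfK// gt_eqF.
have [/(pnorm_eq0 p1) ->|x0] := eqVneq (pnorm r%:E x) 0.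
  by rewrite add0r lerDr pnorm_ge0.
have [/(pnorm_eq0 p1) ->|y0] := eqVneq (pnorm r%:E y) 0.
  by rewrite addr0 lerDl pnorm_ge0.
have := normalized y; have := normalized x.
have := pnorm_ge0 r%:E (x + y).
have := pnorm_ge0 r%:E y; have := pnorm_ge0 r%:E x.
move: x0 y0; have := pnormE (x + y) r1.
move: (pnorm r%:E x) (pnorm r%:E y) (pnorm r%:E (x + y)) => a b c.
move=> cE x0 y0 a_ge0 b_ge0 c_ge0 xE yE.
have a0 : 0 < a by rewrite lt_def x0.
have b0 : 0 < b by rewrite lt_def y0.
have ab0 : 0 < a + b by rewrite addr_gt0.
suff : c `^ r <= (a + b) `^ r.
  apply: contraTT; rewrite -!ltNge => abc.
  by apply: gt0_ltr_powR; rewrite ?nnegrE ?(ltW ab0).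
have coord j : `|(x + y) j 0| `^ r <= (a + b) `^ r *
    (a / (a + b) * (`|x j 0| / a) `^ r + b / (a + b) * (`|y j 0| / b) `^ r).
  apply: le_trans (_ : ((a + b) * (a / (a + b) * (`|x j 0| / a) +
                     b / (a + b) * (`|y j 0| / b))) `^ r <= _).
    have -> : (a + b) * (a / (a + b) * (`|x j 0| / a) + b / (a + b) * (`|y j 0| / b))
        = `|x j 0| + `|y j 0| by field; rewrite x0 y0 gt_eqF.
    by rewrite mxE ge0_ler_powR ?nnegrE ?(ltW r0) ?addr_ge0 ?ler_normD.
  rewrite powRM ?(ltW ab0)//; last first.
    by rewrite addr_ge0// mulr_ge0// divr_ge0// ltW.
  rewrite ler_wpM2l ?powR_ge0// powR_weighted_le// ?divr_ge0// ?ltW//.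
  by rewrite -mulrDl divff ?gt_eqF.
rewrite cE (le_trans (ler_sum _ (fun j _ => coord j)))//.
rewrite -mulr_sumr big_split/= -!mulr_sumr xE// yE// !mulr1.
by rewrite -mulrDl divff ?gt_eqF// mulr1.
Qed.

Lemma pnorm_sum p n (I : finType) (F : I -> 'cV[R]_n) : (1 <= p)%E ->
  pnorm p (\sum_i F i) <= \sum_i pnorm p (F i).
Proof.
move=> p1; elim/big_rec2: _ => [|i y x _ xy].
  by rewrite pnorm0.
by rewrite (le_trans (pnormD _ _ p1))// lerD2l.
Qed.

Lemma pnorm_delta p n (j : 'I_n) : (1 <= p)%E ->
  pnorm p (delta_mx j 0 : 'cV[R]_n) <= 1.
Proof.
case: p => [r| |//].
  rewrite lee_fin => r1; have r0 : r != 0 by rewrite gt_eqF// (lt_le_trans _ r1).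
  rewrite /= (bigD1 j)//= mxE !eqxx normr1 powR1 big1 ?addr0 ?powR1// => i ij.
  by rewrite mxE (negPf ij) normr0 powR0.
move=> _ /=; apply/bigmax_leP; split=> // i _.
by rewrite mxE andbT; case: (i == j); rewrite ?normr1 ?normr0.
Qed.

Lemma pnorm_le_sum p n (x : 'cV[R]_n) : (1 <= p)%E ->
  pnorm p x <= \sum_j `|x j 0|.
Proof.
move=> p1; rewrite {1}(matrix_sum_delta x); under eq_bigr do rewrite big_ord1.
rewrite (le_trans (pnorm_sum _ p1))// ler_sum// => j _.
by rewrite pnormZ// ler_piMr// pnorm_delta.
Qed.

End PNorm.

(** * The induced operator norm *)

Section OpNorm.
Context {R : realType}.

Definition entry_norm n (A : 'M[R]_n) : R := \sum_i \sum_j `|A i j|.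

(** The set whose supremum defines [opnorm] is bounded above: without such a
    bound the value of [sup] would carry no information. *)
Lemma pnorm_mulmx_ball p n (A : 'M[R]_n) (x : 'cV[R]_n) : (1 <= p)%E ->
  pnorm p x <= 1 -> pnorm p (A *m x) <= entry_norm A.
Proof.
move=> p1 x1; rewrite (le_trans (pnorm_le_sum _ p1))// ler_sum// => i _.
rewrite mxE (le_trans (ler_norm_sum _ _ _))// ler_sum// => j _.
by rewrite normrM ler_piMr// (le_trans (coord_le_pnorm _ _ p1)).
Qed.

Lemma pnorm_ball_le_opnorm p n (A : 'M[R]_n) (x : 'cV[R]_n) : (1 <= p)%E ->
  pnorm p x <= 1 -> pnorm p (A *m x) <= opnorm p A.
Proof.
move=> p1 x1; apply: ub_le_sup; last by exists x.
by exists (entry_norm A) => _ [z z1 <-]; exact: pnorm_mulmx_ball.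
Qed.

Lemma opnorm_le p n (A : 'M[R]_n) (c : R) : (1 <= p)%E ->
  (forall x : 'cV[R]_n, pnorm p x <= 1 -> pnorm p (A *m x) <= c) ->
  opnorm p A <= c.
Proof.
move=> p1 Ac; apply: ge_sup => [|_ [x x1 <-]]; last exact: Ac.
by exists (pnorm p (A *m 0)), 0 => //=; rewrite pnorm0.
Qed.

Lemma pnorm_mulmx p n (A : 'M[R]_n) (x : 'cV[R]_n) : (1 <= p)%E ->
  pnorm p (A *m x) <= opnorm p A * pnorm p x.
Proof.
move=> p1; have [/(pnorm_eq0 p1) ->|x0] := eqVneq (pnorm p x) 0.
  by rewrite mulmx0 pnorm0// mulr0.
have xgt0 : 0 < pnorm p x by rewrite lt_def x0 pnorm_ge0.
rewrite -ler_pdivrMr// mulrC -[X in X * _]ger0_norm ?invr_ge0 ?(ltW xgt0)//.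
rewrite -pnormZ// scalemxAr pnorm_ball_le_opnorm// pnormZ//.
by rewrite ger0_norm ?invr_ge0 ?(ltW xgt0)// mulVf.
Qed.

(** Exchanging [A] and [B] makes this a Lipschitz estimate, hence continuity of
    the operator norm in the entries. *)
Lemma opnorm_le_add p n (A B : 'M[R]_n) : (1 <= p)%E ->
  opnorm p A <= opnorm p B + entry_norm (A - B).
Proof.
move=> p1; apply: opnorm_le => // x x1; rewrite -{1}(subrK B A) addrC mulmxDl.
by rewrite (le_trans (pnormD _ _ p1))// lerD ?pnorm_ball_le_opnorm ?pnorm_mulmx_ball.
Qed.

End OpNorm.

(** * Entrywise limits of matrices *)

Section EntrywiseLimits.
Local Open Scope classical_set_scope.
Context {R : realType} {T : Type} (F : set_system T) {FF : Filter F}.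

Lemma cvg_sumr (I : finType) (f : I -> T -> R) (l : I -> R) :
  (forall i, f i x @[x --> F] --> l i) ->
  \sum_i f i x @[x --> F] --> \sum_i l i.
Proof. by move=> fl; apply: cvg_big => //; exact: add_continuous. Qed.

Lemma cvg_prodr (I : finType) (f : I -> T -> R) (l : I -> R) :
  (forall i, f i x @[x --> F] --> l i) ->
  \prod_i f i x @[x --> F] --> \prod_i l i.
Proof. by move=> fl; apply: cvg_big => //; exact: mul_continuous. Qed.

(** Convergence in each entry, the form in which the Leibniz and cofactor
    formulas give the continuity of determinants and adjugates. *)
Definition entry_cvg m n (A : T -> 'M[R]_(m, n)) (B : 'M[R]_(m, n)) :=
  forall i j, A x i j @[x --> F] --> B i j.

Lemma entry_cvg_mulmx m n l (A : T -> 'M[R]_(m, n)) A0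
    (B : T -> 'M[R]_(n, l)) B0 :
  entry_cvg A A0 -> entry_cvg B B0 ->
  entry_cvg (fun x => A x *m B x) (A0 *m B0).
Proof.
move=> AA0 BB0 i j; rewrite mxE; under eq_cvg do rewrite mxE.
by apply: cvg_sumr => k; exact: cvgM.
Qed.

Lemma cvg_det n (A : T -> 'M[R]_n) A0 :
  entry_cvg A A0 -> \det (A x) @[x --> F] --> \det A0.
Proof.
move=> AA0; apply: cvg_sumr => s; apply: cvgM; first exact: cvg_cst.
by apply: cvg_prodr => i; exact: AA0.
Qed.

Lemma entry_cvg_adj n (A : T -> 'M[R]_n) A0 :
  entry_cvg A A0 -> entry_cvg (fun x => \adj (A x)) (\adj A0).
Proof.
move=> AA0 i j; rewrite mxE; under eq_cvg do rewrite mxE.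
apply: cvgM; first exact: cvg_cst.
apply: cvg_det => k l; rewrite !mxE; under eq_cvg do rewrite !mxE.
exact: AA0.
Qed.

Lemma cvg_opnorm p n (A : T -> 'M[R]_n) A0 : (1 <= p)%E ->
  entry_cvg A A0 -> opnorm p (A x) @[x --> F] --> opnorm p A0.
Proof.
move=> p1 AA0; have dist0 : entry_norm (A x - A0) @[x --> F] --> (0 : R).
  have -> : (0 : R) = entry_norm (A0 - A0).
    by rewrite subrr /entry_norm !big1// => i _; rewrite big1// => j _; rewrite mxE normr0.
  apply: cvg_sumr => i; apply: cvg_sumr => j; apply: cvg_norm.
  rewrite !mxE; under eq_cvg do rewrite !mxE.
  by apply: cvgB; [exact: AA0|exact: cvg_cst].
apply: (@squeeze_cvgr _ _ _ _ (fun x => opnorm p A0 - entry_norm (A x - A0))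
          (fun x => opnorm p A0 + entry_norm (A x - A0))).
- near=> x; rewrite lerBlDr !opnorm_le_add// andbT.
  rewrite (le_trans (opnorm_le_add _ (A x) p1))// lerD2l /entry_norm.
  rewrite le_eqVlt; apply/orP; left; apply/eqP.
  by apply: eq_bigr => i _; apply: eq_bigr => j _; rewrite !mxE distrC.
- by rewrite -[X in _ --> X]subr0; apply: cvgB => //; exact: cvg_cst.
- by rewrite -[X in _ --> X]addr0; apply: cvgD => //; exact: cvg_cst.
Unshelve. all: by end_near. Qed.

End EntrywiseLimits.

(** * Convex combinations *)

Section ConvexCombinations.
Context {R : realFieldType} {I : finType}.

Lemma weighted_sum0_le0 (d u : I -> R) : (forall i, 0 <= d i) ->
  \sum_i d i = 1 -> \sum_i d i * u i = 0 -> exists i, u i <= 0.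
Proof.
move=> d0 d1 du0; apply: contrapT => /forallNP u0.
have {}u0 i : 0 < u i by rewrite ltNge; apply/negP/u0.
have du i : 0 <= d i * u i by rewrite mulr_ge0// ltW.
have d00 : \sum_i d i = 0.
  apply: big1 => i _; apply/eqP; move/eqP: du0; rewrite psumr_eq0//.
  by move=> /allP/(_ i (mem_index_enum _)); rewrite mulf_eq0 (gt_eqF (u0 i)) orbF.
by have := oner_neq0 R; rewrite -d1 d00 eqxx.
Qed.

Lemma crossing_weights (u : I -> R) a b :
  u a <= 0 -> 0 <= u b ->
  exists d : I -> R, [/\ forall i, 0 <= d i, \sum_i d i = 1 &
    \sum_i d i * u i = 0].
Proof.
move=> ua ub.
(* The zero of the affine function joining [u b] at 0 to [u a] at 1; any [t]
   works in the degenerate case [u a = u b = 0]. *)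
have [t [t0 t1 tu]] : exists t : R, [/\ 0 <= t, t <= 1 & t * u a + (1 - t) * u b = 0].
  have [ab|ab] := leP (u b) (u a).
    by exists 1; split=> //; lra.
  exists (u b / (u b - u a)); have ab0 : 0 < u b - u a by rewrite subr_gt0.
  split; first by rewrite divr_ge0// ltW.
    by rewrite ler_pdivrMr// mul1r; lra.
  by field; rewrite gt_eqF.
have sum1 (c : I) (g : I -> R) : \sum_i (i == c)%:R * g i = g c.
  rewrite (bigD1 c)//= eqxx mul1r big1 ?addr0// => i /negPf ->.
  by rewrite mul0r.
exists (fun i => t * (i == a)%:R + (1 - t) * (i == b)%:R); split.
- by move=> i; rewrite addr_ge0// mulr_ge0// ?subr_ge0// ler0n.
- rewrite big_split/= -!mulr_sumr.
  have s1 (c : I) : \sum_i ((i == c)%:R : R) = 1.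
    by rewrite -[RHS](sum1 c (fun=> 1)); under [RHS]eq_bigr do rewrite mulr1.
  by rewrite !s1; ring.
- under eq_bigr do rewrite mulrDl -!mulrA.
  by rewrite big_split/= -!mulr_sumr !sum1.
Qed.

End ConvexCombinations.

Lemma unitmx_ker0 (F : fieldType) n (A : 'M[F]_n) :
  (forall x : 'cV_n, A *m x = 0 -> x = 0) -> A \in unitmx.
Proof.
move=> kerA; rewrite -unitmx_tr -row_free_unit -kermx_eq0; apply/rowV0P => v.
move/sub_kermxP/(congr1 trmx); rewrite trmx_mul trmxK trmx0 => /kerA v0.
by rewrite -[v]trmxK v0 trmx0.
Qed.

(** * The row W-property *)

Section RowW.
Context {R : realType} {n k : nat}.
Implicit Types (M D : 'I_k.+1 -> 'M[R]_n) (q : 'I_k.+1 -> 'cV[R]_n).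
Implicit Types (x y : 'cV[R]_n) (J : 'I_n -> {set 'I_k.+1}).

Lemma row_W_eq0 M x : row_W_property M ->
  (forall j, exists i, (M i *m x) j 0 <= 0) ->
  (forall j, exists i, 0 <= (M i *m x) j 0) -> x = 0.
Proof.
move=> hM hle hge; apply: hM => j; rewrite mxE.
  by have [i] := hle j; apply: le_trans; exact: bigmin_le.
by have [i /le_trans] := hge j; apply; exact: (le_bigmax _ (fun i => (M i *m x) j 0)).
Qed.

Lemma row_W_inj M x y : row_W_property M ->
  (forall j, exists i, (M i *m x) j 0 <= (M i *m y) j 0) ->
  (forall j, exists i, (M i *m y) j 0 <= (M i *m x) j 0) -> x = y.
Proof.
move=> hM hle hge; apply/eqP; rewrite -subr_eq0; apply/eqP.
apply: (row_W_eq0 hM) => j.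
  by have [i] := hle j; exists i; rewrite mulmxBr mxE [X in _ + X]mxE subr_le0.
by have [i] := hge j; exists i; rewrite mulmxBr mxE [X in _ + X]mxE subr_ge0.
Qed.

Lemma diag_tuplesP D : diag_tuples D ->
  [/\ forall i j x, (D i *m x) j 0 = D i j j * x j 0,
      forall i j, 0 <= D i j j & forall j, \sum_i D i j j = 1].
Proof.
case=> Ddiag D01 D1; split=> [i j x|i j|j].
- rewrite mxE (bigD1 j)//= big1 ?addr0// => l lj.
  by have /is_diag_mxP -> := Ddiag i; rewrite ?mul0r// eq_sym.
- by have /andP[] := D01 i j.
- by rewrite -summxE D1 mxE eqxx.
Qed.

Lemma S_mx_coord M D x j : diag_tuples D ->
  (S_mx M D *m x) j 0 = \sum_i D i j j * (M i *m x) j 0.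
Proof.
move=> /diag_tuplesP[DE _ _]; rewrite mulmx_suml summxE.
by apply: eq_bigr => i _; rewrite -mulmxA DE.
Qed.

(** If [S_mx M D *m x = 0], each row is a vanishing convex combination of the
    entries of the [M i *m x], which therefore do not all have the same strict
    sign. *)
Lemma S_mx_unit M D : row_W_property M -> diag_tuples D -> S_mx M D \in unitmx.
Proof.
move=> hM hD; have [_ D0 D1] := diag_tuplesP hD.
apply: unitmx_ker0 => x Sx0.
have Sx j : \sum_i D i j j * (M i *m x) j 0 = 0.
  by rewrite -S_mx_coord// Sx0 mxE.
apply: (row_W_eq0 hM) => j.
  exact: (weighted_sum0_le0 (D0^~ j) (D1 j) (Sx j)).
have [|i] := @weighted_sum0_le0 _ _ (fun i => D i j j)
    (fun i => - (M i *m x) j 0) (D0^~ j) (D1 j).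
  by under eq_bigr do rewrite mulrN; rewrite sumrN Sx oppr0.
by rewrite oppr_le0; exists i.
Qed.

(** * Unique solvability *)

Definition residual M (q : 'I_k.+1 -> 'cV[R]_n) x i j : R :=
  (M i *m x + q i) j 0.

Lemma residual_le M q x y i j :
  (residual M q x i j <= residual M q y i j) =
  ((M i *m x) j 0 <= (M i *m y) j 0).
Proof. by rewrite /residual !mxE lerD2r. Qed.

(** The problem in which row [j] may only use the indices in [J j]. Letting these
    sets vary is what makes the induction of [selective_sol_exists] possible. *)
Definition selective_sol M q (J : 'I_n -> {set 'I_k.+1}) x := forall j,
  (forall i, i \in J j -> 0 <= residual M q x i j) /\
  (exists2 i, i \in J j & residual M q x i j = 0).

Lemma EVLCP_solP M q x :
  EVLCP_sol M q x <-> selective_sol M q (fun=> [set: 'I_k.+1]%SET) x.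
Proof.
split=> [/colP sol j|sol].
  have := sol j; rewrite [LHS]mxE [RHS]mxE => min0; split=> [i _|].
    by rewrite -[leLHS]min0; exact: (bigmin_le _ _ (fun i => (M i *m x + q i) j 0)).
  have some_le0 : exists i, residual M q x i j <= 0.
    move: (lexx (0 : R)); rewrite -{1}min0 => /bigmin_leP[|[i _]] le0.
      by exists ord0.
    by exists i.
  have [i ile0] := some_le0; exists i; rewrite ?inE//; apply/le_anti.
  rewrite ile0 -[leLHS]min0.
  exact: (bigmin_le _ _ (fun i => (M i *m x + q i) j 0)).
apply/colP => j; rewrite [LHS]mxE [RHS]mxE; have [ge0 [i _ i0]] := sol j.
apply/le_anti/andP; split; last by apply: le_bigmin => [|l _]; apply: ge0; rewrite inE.
by rewrite -[leRHS]i0; exact: (bigmin_le _ _ (fun i => (M i *m x + q i) j 0)).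
Qed.

(** At an index where the residual of one solution vanishes, that of the other
    is nonnegative: in each row the residuals compare in both directions. *)
Lemma selective_sol_inj M q J x y : row_W_property M ->
  selective_sol M q J x -> selective_sol M q J y -> x = y.
Proof.
move=> hM hx hy; apply: (row_W_inj hM) => j.
  have [_ [i iJ xi0]] := hx j; exists i.
  by rewrite -(residual_le M q) xi0 (hy j).1.
have [_ [i iJ yi0]] := hy j; exists i.
by rewrite -(residual_le M q) yi0 (hx j).1.
Qed.

Lemma selective_sol_set1 M q J : row_W_property M ->
  (forall j, #|J j| = 1) -> exists x, selective_sol M q J x.
Proof.
move=> hM J1; have /choice[f Jf] j : exists i, J j = [set i]%SET.
  by apply/cards1P; rewrite J1.
(* Row [j] only uses the index [f j], so the problem is the linear system
   whose row [j] is that of [M (f j)]. *)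
pose A := \matrix_(j, l) M (f j) j l.
have Acoord x j : (A *m x) j 0 = (M (f j) *m x) j 0.
  by rewrite !mxE; apply: eq_bigr => l _; rewrite mxE.
have Aunit : A \in unitmx.
  apply: unitmx_ker0 => x Ax0; apply: (row_W_eq0 hM) => j;
    by exists (f j); rewrite -Acoord Ax0 mxE.
exists (invmx A *m - \col_j q (f j) j 0) => j.
have res0 : residual M q (invmx A *m - \col_j q (f j) j 0) (f j) j = 0.
  by rewrite /residual mxE -Acoord mulKVmx// !mxE addNr.
rewrite Jf; split=> [i /set1P -> |]; first by rewrite res0.
by exists (f j); rewrite ?set11.
Qed.

(** Induction on the total number of allowed indices: of the two solutions
    obtained by splitting [J j] into [J j :\ b] and [[set b]], one solves the
    problem for [J] itself. Which one is decided by the sign of the residual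
    of [x] at [b], and the W-property rules out that both fail. *)
Lemma selective_sol_exists M q J : row_W_property M ->
  (forall j, J j != finset.set0) -> exists x, selective_sol M q J x.
Proof.
move=> hM; have [N] := ubnP (\sum_j #|J j|)%N; elim: N J => // N IH J JN J0.
have [Jle1|] := boolP [forall j, #|J j| <= 1]%N.
  apply: selective_sol_set1 => // => j; apply/eqP.
  by rewrite eqn_leq (forallP Jle1 j) card_gt0 J0.
rewrite negb_forall => /existsP[j]; rewrite -ltnNge => Jj1.
have /set0Pn[b bJ] := J0 j.
have restrict (B : {set 'I_k.+1}) : B \proper J j -> B != finset.set0 ->
    exists x, selective_sol M q (fun l => if l == j then B else J l) x.
  move=> BJ B0; apply: IH => [|l]; last by case: ifP.
  move: JN; rewrite ltnS; apply: leq_trans.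
  rewrite (bigD1 j)//= [ltnRHS](bigD1 j)//= eqxx -addSn leq_add//.
    exact: proper_card.
  by apply: leq_sum => l /negPf ->.
have [x hx] : exists x, selective_sol M q (fun l => if l == j then J j :\ b else J l) x.
  apply: restrict; first exact: properD1.
  by move: Jj1; rewrite -card_gt0 (cardsD1 b) bJ.
have [y hy] : exists y, selective_sol M q (fun l => if l == j then [set b]%SET else J l) y.
  apply: restrict; last by rewrite -card_gt0 cards1.
  by rewrite properEcard finset.sub1set bJ cards1.
have [xb_ge0|xb_lt0] := leP 0 (residual M q x b j).
  exists x => l; have := hx l; have [->|//] := eqVneq l j.
  move=> [ge0 [a /setD1P[_ aJ] a0]]; split=> [i iJ|]; last by exists a.
  by have [->//|ib] := eqVneq i b; apply: ge0; rewrite !inE ib.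
have := hy j; rewrite eqxx => -[_ [_ /set1P -> yb0]].
have [yJ_ge0|] := pselect (forall i, i \in J j -> 0 <= residual M q y i j).
  exists y => l; have := hy l; have [->_|//] := eqVneq l j.
  by split=> //; exists b.
(* Both fail: in row [j] the residual of [x] is [< 0] and that of [y] is 0 at
   [b], while at [a] that of [y] is [< 0] and that of [x] is [>= 0]. *)
move=> /existsNP[a /not_implyP[aJ /negP]]; rewrite -ltNge => ya_lt0.
have ab : a != b by apply: contraTneq ya_lt0 => ->; rewrite yb0 ltxx.
have hxj := hx j; rewrite eqxx in hxj.
suff xy : x = y by rewrite xy yb0 ltxx in xb_lt0.
apply: (row_W_inj hM) => l; have [->|lj] := eqVneq l j.
- by exists b; rewrite -(residual_le M q) yb0 ltW.
- have := hx l; rewrite (negPf lj) => -[_ [i iJ xi0]].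
  have := hy l; rewrite (negPf lj) => -[/(_ i iJ) yi_ge0 _].
  by exists i; rewrite -(residual_le M q) xi0.
- exists a; rewrite -(residual_le M q) (le_trans (ltW ya_lt0))//.
  by apply: hxj.1; rewrite !inE ab.
- have := hy l; rewrite (negPf lj) => -[_ [i iJ yi0]].
  have := hx l; rewrite (negPf lj) => -[/(_ i iJ) xi_ge0 _].
  by exists i; rewrite -(residual_le M q) yi0.
Qed.

End RowW.

(** * Attainment of the maximum defining alpha *)

Section Alpha.
Local Open Scope classical_set_scope.
Context {R : realType} {n k : nat}.
Implicit Types (M D : 'I_k.+1 -> 'M[R]_n) (w : 'rV[R]_(k.+1 * n)).

(** The diagonal entries of all the matrices are gathered in one row vector, so
    that the tuples of [diag_tuples] correspond to a closed subset of a box. *)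
Definition diag_of_row w (i : 'I_k.+1) : 'M[R]_n :=
  diag_mx (row i (vec_mx w)).

Definition weight_rows : set 'rV[R]_(k.+1 * n) :=
  [set w | forall c, `[0, 1] (w ord0 c)] `&`
  \bigcap_(j in [set: 'I_n])
    [set w | \sum_(i < k.+1) w ord0 (mxvec_index i j) = 1].

Lemma diag_of_row_tuple w : weight_rows w -> diag_tuples (diag_of_row w).
Proof.
move=> [w01 w1]; split=> [i|i j|].
- exact: diag_mx_is_diag.
- by rewrite !mxE eqxx mulr1n; have := w01 (mxvec_index i j); rewrite /= in_itv.
- apply/matrixP => a b; rewrite summxE mxE; under eq_bigr do rewrite !mxE.
  by rewrite sumrMnl; congr (_ *+ _); exact: w1.
Qed.

Lemma diag_tuple_of_row D : diag_tuples D ->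
  exists2 w, weight_rows w & D = diag_of_row w.
Proof.
move=> hD; have [_ _ D1] := diag_tuplesP hD; case: hD => Ddiag D01 _.
exists (mxvec (\matrix_(i, j) D i j j)).
  split=> [c|j _] /=.
    by case/mxvec_indexP: c => i j; rewrite mxvecE mxE in_itv/=; exact: D01.
  by under eq_bigr do rewrite mxvecE mxE; exact: D1.
apply/funext => i; apply/matrixP => a b; rewrite !mxE mxvecE mxE.
have [->|ab] := eqVneq a b; first by rewrite mulr1n.
by have /is_diag_mxP -> := Ddiag i.
Qed.

Lemma weight_rows_compact : compact weight_rows.
Proof.
apply: compact_closedI.
  by apply: (@rV_compact R _ (fun=> `[0, 1])) => c; exact: segment_compact.
apply: closed_bigI => j _; apply: preimage_closed (@closed_eq R 1).
move=> w _; apply: (@cvg_sumr _ _ (nbhs w)) => i; exact: coord_continuous.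
Qed.

Lemma entry_cvg_diag_of_row w i : entry_cvg (nbhs w) (diag_of_row^~ i) (diag_of_row w i).
Proof.
move=> a b; rewrite !mxE; under eq_cvg do rewrite !mxE.
by case: (a == b); [exact: coord_continuous|exact: cvg_cst].
Qed.

Lemma entry_cvg_S_mx_diag M w :
  entry_cvg (nbhs w) (fun v => S_mx M (diag_of_row v)) (S_mx M (diag_of_row w)).
Proof.
move=> a b; rewrite summxE; under eq_cvg do rewrite summxE.
apply: cvg_sumr => i; apply: entry_cvg_mulmx; first exact: entry_cvg_diag_of_row.
by move=> c d; exact: cvg_cst.
Qed.

(** The norm is a continuous function of the weights, which range over a compact
    set; the inverse causes no trouble since [S_mx M D] is invertible all over
    that set. *)
Lemma opnorm_attains_max p M i : (1 <= p)%E -> row_W_property M ->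
  exists2 D0, diag_tuples D0 & forall D, diag_tuples D ->
    opnorm p (invmx (S_mx M D) *m D i) <= opnorm p (invmx (S_mx M D0) *m D0 i).
Proof.
move=> p1 hM.
pose S w := S_mx M (diag_of_row w).
(* Cramer's formula replaces [invmx], with which it agrees at invertible
   matrices, because its continuity there needs no knowledge of nearby points. *)
pose f w := opnorm p ((\det (S w))^-1 *: \adj (S w) *m diag_of_row w i).
have fE w : weight_rows w ->
    f w = opnorm p (invmx (S_mx M (diag_of_row w)) *m diag_of_row w i).
  by move=> /diag_of_row_tuple/(S_mx_unit hM) Su; rewrite /f /invmx Su.
have fc : {within weight_rows, continuous f}.
  apply: continuous_in_subspaceT => w /set_mem/diag_of_row_tuple/(S_mx_unit hM).
  rewrite unitmxE unitfE => S0.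
  have Sinv : entry_cvg (nbhs w) (fun v => (\det (S v))^-1 *: \adj (S v))
      ((\det (S w))^-1 *: \adj (S w)).
    move=> a b; rewrite mxE; under eq_cvg do rewrite mxE.
    apply: cvgM; last exact: (entry_cvg_adj (@entry_cvg_S_mx_diag M w)).
    by apply: cvgV => //; exact: (cvg_det (@entry_cvg_S_mx_diag M w)).
  exact: (@cvg_opnorm _ _ (nbhs w) _ _ _ _ _ p1
    (entry_cvg_mulmx Sinv (@entry_cvg_diag_of_row w i))).
have weight_neq0 : weight_rows !=set0.
  have [|w hw _] := @diag_tuple_of_row (fun i => if i == ord0 then 1%:M else 0).
    split=> [l|l j|].
    - by case: ifP => _; rewrite ?scalar_mx_is_diag ?mx0_is_diag.
    - by case: ifP => _; rewrite mxE ?eqxx ?lexx ?ler01.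
    - by rewrite (bigD1 ord0)//= big1 ?addr0// => l /negPf ->.
  by exists w.
have [w /set_mem hw wmax] := compact_EVT_max weight_neq0 weight_rows_compact fc.
exists (diag_of_row w); first exact: diag_of_row_tuple.
by move=> _ /diag_tuple_of_row[v hv ->]; rewrite -!fE// wmax// inE.
Qed.

(** [set_max] returns a default value on a set without greatest element, hence
    the role of [opnorm_attains_max]. *)
Lemma opnorm_le_alpha p M D i : (1 <= p)%E -> row_W_property M ->
  diag_tuples D -> opnorm p (invmx (S_mx M D) *m D i) <= alpha p M i.
Proof.
move=> p1 hM hD; have [D0 hD0 D0max] := opnorm_attains_max i p1 hM.
rewrite /alpha /set_max.
set A := [set opnorm p (invmx (S_mx M E) *m E i) | E in _].
have : (A `&` ubound A) (xget 0 (A `&` ubound A)).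
  apply: xgetPex; exists (opnorm p (invmx (S_mx M D0) *m D0 i)).
  by split=> [|_ [E hE <-]]; [exists D0|exact: D0max].
by move=> [_]; apply; exists D.
Qed.

End Alpha.

(** * The difference of two solutions *)

(** In row [j] the difference of the residuals of [x] and [y] is [<= 0] where the
    residual of [x] vanishes, and [>= 0] where that of [y] vanishes; so it has
    a vanishing convex combination, whose weights are the [j]-th diagonal
    entries of the matrices [D i]. *)
Lemma difference_weights (R : realType) n k (M : 'I_k.+1 -> 'M[R]_n)
    (q qt : 'I_k.+1 -> 'cV[R]_n) (x y : 'cV[R]_n) :
  EVLCP_sol M q x -> EVLCP_sol M qt y ->
  exists2 D, diag_tuples D &
    S_mx M D *m (x - y) = \sum_i D i *m (qt i - q i).
Proof.
move=> /EVLCP_solP hx /EVLCP_solP hy.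
pose u j i := residual M q x i j - residual M qt y i j.
have /choice[d hd] j : exists d : 'I_k.+1 -> R, [/\ forall i, 0 <= d i,
    \sum_i d i = 1 & \sum_i d i * u j i = 0].
  have [x0 [a _ xa]] := hx j; have [y0 [b _ yb]] := hy j.
  apply: (crossing_weights (a := a) (b := b)).
    by rewrite /u xa sub0r oppr_le0 y0// inE.
  by rewrite /u yb subr0 x0// inE.
pose D i : 'M[R]_n := diag_mx (\row_j d j i).
have hD : diag_tuples D.
  split=> [i|i j|].
  - exact: diag_mx_is_diag.
  - have [d0 d1 _] := hd j; rewrite !mxE eqxx mulr1n d0/= -d1 (bigD1 i)//= lerDl.
    by apply: sumr_ge0 => l _.
  - apply/matrixP => a b; rewrite summxE mxE; under eq_bigr do rewrite !mxE.
    by rewrite sumrMnl; have [_ -> _] := hd a.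
have [DE _ _] := diag_tuplesP hD.
exists D => //; apply/colP => j; rewrite S_mx_coord// summxE.
have [_ _ /eqP] := hd j.
have -> : \sum_i d j i * u j i = \sum_i D i j j * (M i *m (x - y)) j 0 -
    \sum_i (D i *m (qt i - q i)) j 0.
  rewrite -sumrB; apply: eq_bigr => i _; rewrite DE -mulrBr.
  have -> : D i j j = d j i by rewrite !mxE eqxx mulr1n.
  congr (_ * _).
  have -> : u j i = ((M i *m x + q i) - (M i *m y + qt i)) j 0.
    by rewrite [RHS]mxE [X in _ + X]mxE.
  rewrite opprD addrACA -mulmxBr -[q i - qt i]opprB.
  by rewrite mxE [X in _ + X]mxE.
by rewrite subr_eq0 => /eqP.
Qed.

Theorem theorem3p1 (R : realType) (n k : nat) (p : \bar R) (hp : (1 <= p)%E)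
    (M : 'I_k.+1 -> 'M[R]_n) (hM : row_W_property M)
    (q qt : 'I_k.+1 -> 'cV[R]_n) :
  exists xs ys : 'cV[R]_n,
    [/\ unique (EVLCP_sol M q) xs,
        unique (EVLCP_sol M qt) ys &
        pnorm p (xs - ys) <= \sum_(i < k.+1) alpha p M i * pnorm p (qt i - q i)].
Proof.
have setT_neq0 (j : 'I_n) : [set: 'I_k.+1]%SET != finset.set0.
  by apply/set0Pn; exists ord0; rewrite inE.
have solvable r : exists x, unique (EVLCP_sol M r) x.
  have [x hx] := selective_sol_exists r hM setT_neq0.
  exists x; split=> [|y /EVLCP_solP hy]; first exact/EVLCP_solP.
  exact: (selective_sol_inj hM hx hy).
have [[xs hxs] [ys hys]] := (solvable q, solvable qt).
exists xs, ys; split=> //.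
have [D hD SD] := difference_weights hxs.1 hys.1.
rewrite -(mulKmx (S_mx_unit hM hD) (xs - ys)) SD mulmx_sumr.
rewrite (le_trans (pnorm_sum _ hp))// ler_sum// => i _; rewrite mulmxA.
by rewrite (le_trans (pnorm_mulmx _ _ hp))// ler_wpM2r ?pnorm_ge0 ?opnorm_le_alpha.
Qed.
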